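(* Let $(b,x_b,y_b)$ be a lower model, that is, $b\in\mathbb R$, $x_b\in\mathcal X$, $y_b\in\mathcal Y$, and $$f(x,y_b)\ \ge\ q_b(x)=b+\frac\sigma2\|x-x_b\|^2\quad\forall x\in\mathcal X,\qquad\sigma=\mu/2.$$ Let $y_c\in\mathcal Y$, let $K\ge1$ be an integer, let $(u,z,A)=\mathrm{Block}(f(\cdot,y_c),q_b,K)$, and let $v=f(u,y_c)$. Put $\vartheta=A/(1+A)$. Then the triple $$b^+=\frac{b+Av}{1+A},\qquad x_b^+=z,\qquad y_b^+=(1-\vartheta)y_b+\vartheta y_c=\frac{y_b+Ay_c}{1+A}$$ is again a lower model: $x_b^+\in\mathcal X$, $y_b^+\in\mathcal Y$, and $f(x,y_b^+)\ge b^++\frac\sigma2\|x-x_b^+\|^2$ for all $x\in\mathcal X$.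
   Context: $\|\cdot\|$ is the Euclidean norm. $\mathcal X\subseteq\mathbb R^n$ is nonempty, closed, convex, bounded; $\mathcal Y\subset\mathbb R^m$ is a compact convex set with nonempty interior in its affine hull. $f:\mathcal X\times\mathcal Y\to\mathbb R$; for every $y\in\mathcal Y$, $f(\cdot,y)$ is $\mu$-strongly convex and $L$-smooth on $\mathcal X$ with $\mu>0$; for every $x\in\mathcal X$, $f(x,\cdot)$ is concave on $\mathcal Y$ (and has supergradients bounded in norm by a constant $M_y$). Block. For $F$ $\mu_F$-strongly convex and $L_F$-smooth on $\mathcal X$, $\pi(x)=c+\frac\gamma2\|x-\bar x\|^2$ with $\gamma>0$, $\bar x\in\mathcal X$, $\mathrm{Block}(F,\pi,K)$ is: $A_0=0$, $\Gamma_0=\gamma$, $u_0=z_0=\bar x$, $r_0=\gamma\bar x$; for $i=1,\dots,K$: $a_i=\frac{(i+1)\gamma}{2L_F}$, $A_i=A_{i-1}+a_i$, $\Gamma_i=\Gamma_{i-1}+\mu_Fa_i$, $x_i=\frac{A_{i-1}u_{i-1}+a_iz_{i-1}}{A_i}$, $g_i=\nabla F(x_i)$, $r_i=r_{i-1}+a_i(\mu_Fx_i-g_i)$, $z_i=\operatorname{proj}_{\mathcal X}(r_i/\Gamma_i)$ (Euclidean projection), $u_i=\frac{A_{i-1}u_{i-1}+a_iz_i}{A_i}$. Output $(u_K,z_K,A_K)$. Here it is applied with $F=f(\cdot,y_c)$, $\mu_F=\mu$, $L_F=L$, $\pi=q_b$, i.e. $c=b$, $\gamma=\sigma$, $\bar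 x=x_b$. *)

(* Defs.v *)
(* R^n is 'rV[R]_n for an arbitrary R : realType.  The library norm on 'rV[R]_n
   is the sup norm, so the Euclidean norm is defined here; both induce the same
   topology, hence closed, compact, bounded_set and interior are the library
   notions. *)
From HB Require Import structures.
From mathcomp Require Import all_boot all_order all_algebra.
From mathcomp Require Import all_classical all_reals all_analysis.

Set Implicit Arguments.
Unset Strict Implicit.
Unset Printing Implicit Defensive.

Import Order.TTheory GRing.Theory Num.Theory.
Import numFieldNormedType.Exports.

Local Open Scope classical_set_scope.
Local Open Scope ring_scope.

Section Euclidean.
Context {R : realType} {n : nat}.
Implicit Types (x w : 'rV[R]_n) (A : set 'rV[R]_n) (F : 'rV[R]_n -> R).

Definition dotv x w : R := \sum_(i < n) x 0 i * w 0 i.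

Definition enorm x : R := Num.sqrt (dotv x x).

Definition affine_hull A : set 'rV[R]_n :=
  [set x | exists (k : nat) (p : 'I_k -> 'rV[R]_n) (l : 'I_k -> R),
     [/\ forall i, A (p i), \sum_(i < k) l i = 1
       & x = \sum_(i < k) l i *: p i]].

(* The interior is taken in the topology that the affine hull inherits
   from R^n. *)
Definition has_relative_interior A : Prop :=
  @interior (subspace (affine_hull A)) A !=set0.

(* [get _ | _] is meaningful when A is nonempty, closed and convex: the nearest
   point then exists and is unique. *)
Definition eproj A x : 'rV[R]_n :=
  [get z | A z /\ forall w, A w -> enorm (x - z) <= enorm (x - w)].

Definition strongly_convex_on A (mu : R) F : Prop :=
  forall x w (t : R), A x -> A w -> 0 <= t <= 1 ->
    F (t *: x + (1 - t) *: w) <=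
    t * F x + (1 - t) * F w - mu / 2 * (t * (1 - t)) * enorm (x - w) ^+ 2.

(* g is a gradient at x of F viewed as a function on A: values of F outside A
   are irrelevant.  The ambient gradient is one whenever F is differentiable at
   x in R^n; when A has empty interior g need not be unique. *)
Definition gradient_within A F x (g : 'rV[R]_n) : Prop :=
  forall e : R, 0 < e ->
    \forall w \near within A (nbhs x),
      `|F w - F x - dotv g (w - x)| <= e * enorm (w - x).

(* F is L-smooth on A, with gradient map dF. *)
Definition smooth_on A (L : R) F (dF : 'rV[R]_n -> 'rV[R]_n) : Prop :=
  (forall x, A x -> gradient_within A F x (dF x)) /\
  (forall x w, A x -> A w -> enorm (dF x - dF w) <= L * enorm (x - w)).

Definition concave_on A F : Prop :=
  @convex_function R _ A (fun x => - F x).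

Definition supergradient A F x (s : 'rV[R]_n) : Prop :=
  forall w, A w -> F w <= F x + dotv s (w - x).

(* The quadratic x |-> c + gamma / 2 * |x - xbar|^2. *)
Record quad := Quad { qconst : R; qcurv : R; qcenter : 'rV[R]_n }.

Definition quad_eval (q : quad) x : R :=
  qconst q + qcurv q / 2 * enorm (x - qcenter q) ^+ 2.

Record block_state := BlockState {
  bA : R; bGamma : R; bu : 'rV[R]_n; bz : 'rV[R]_n; br : 'rV[R]_n }.

Definition block_init (q : quad) : block_state :=
  BlockState 0 (qcurv q) (qcenter q) (qcenter q) (qcurv q *: qcenter q).

(* i-th step, i >= 1, from the state of index i - 1. *)
Definition block_step A (muF LF : R) (dF : 'rV[R]_n -> 'rV[R]_n)
    (gamma : R) (i : nat) (s : block_state) : block_state :=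
  let a := (i + 1)%:R * gamma / (2 * LF) in
  let A' := bA s + a in
  let Gamma' := bGamma s + muF * a in
  let x := A'^-1 *: (bA s *: bu s + a *: bz s) in
  let g := dF x in
  let r' := br s + a *: (muF *: x - g) in
  let z' := eproj A (Gamma'^-1 *: r') in
  let u' := A'^-1 *: (bA s *: bu s + a *: z') in
  BlockState A' Gamma' u' z' r'.

Fixpoint block_iter A (muF LF : R) (dF : 'rV[R]_n -> 'rV[R]_n)
    (q : quad) (k : nat) : block_state :=
  if k is k'.+1
  then block_step A muF LF dF (qcurv q) k (block_iter A muF LF dF q k')
  else block_init q.

(* F enters only through its gradient map dF. *)
Definition block A (muF LF : R) (dF : 'rV[R]_n -> 'rV[R]_n)
    (q : quad) (K : nat) : 'rV[R]_n * 'rV[R]_n * R :=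
  let s := block_iter A muF LF dF q K in (bu s, bz s, bA s).

End Euclidean.

Arguments quad R n : clear implicits.
Arguments block_state R n : clear implicits.

Definition lower_model (R : realType) (n m : nat)
    (X : set 'rV[R]_n) (Y : set 'rV[R]_m) (f : 'rV[R]_n -> 'rV[R]_m -> R)
    (sigma b : R) (xb : 'rV[R]_n) (yb : 'rV[R]_m) : Prop :=
  [/\ X xb, Y yb
    & forall x, X x -> quad_eval (Quad b sigma xb) x <= f x yb].

(* Main.v *)
(* Block maintains an estimate function k + Gamma/2 |x|^2 - <r, x> which lies
   below pi + A F on X, whose minimum over X is attained at z, and whose minimum
   is at least c + A F(u).  A step adds a_i times the strongly convex lower bound
   of F at x_i; the bound on the minimum survives because u_i - x_i is
   a_i/A_i (z_i - z_{i-1}) and L a_i^2 <= Gamma_{i-1} A_i, so that the descent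
   inequality for F at x_i is paid for by the curvature Gamma_{i-1}.  Hence
   pi + A F >= c + A F(u) + Gamma/2 |x - z|^2 on X, with Gamma = gamma + mu A.
   Concavity of f in y turns the average of the two lower bounds into a lower
   bound at y_b^+, and (sigma + mu A) / (1 + A) >= sigma. *)
Require Import Defs.
From HB Require Import structures.
From mathcomp Require Import all_boot all_order all_algebra.
From mathcomp Require Import all_classical all_reals all_analysis.
From mathcomp Require Import ring lra.

Set Implicit Arguments.
Unset Strict Implicit.
Unset Printing Implicit Defensive.

Import Order.TTheory GRing.Theory Num.Theory.
Import numFieldNormedType.Exports.

Local Open Scope classical_set_scope.
Local Open Scope ring_scope.

(** * Euclidean inner product and norm *)

Section DotProduct.
Context {R : realType} {n : nat}.
Implicit Types (x w p : 'rV[R]_n) (a : R).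

Lemma dotvC x w : dotv x w = dotv w x.
Proof. by apply: eq_bigr => i _; rewrite mulrC. Qed.

Lemma dotvDr p x w : dotv p (x + w) = dotv p x + dotv p w.
Proof. by rewrite -big_split; apply: eq_bigr => i _; rewrite mxE mulrDr. Qed.

Lemma dotvZr a p x : dotv p (a *: x) = a * dotv p x.
Proof. by rewrite /dotv mulr_sumr; apply: eq_bigr => i _; rewrite mxE; ring. Qed.

Lemma dotvNr p x : dotv p (- x) = - dotv p x.
Proof. by rewrite -scaleN1r dotvZr mulN1r. Qed.

Lemma dotvDl p x w : dotv (x + w) p = dotv x p + dotv w p.
Proof. by rewrite !(dotvC _ p) dotvDr. Qed.

Lemma dotvZl a p x : dotv (a *: x) p = a * dotv x p.
Proof. by rewrite !(dotvC _ p) dotvZr. Qed.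

Lemma dotvNl p x : dotv (- x) p = - dotv x p.
Proof. by rewrite !(dotvC _ p) dotvNr. Qed.

Definition dotvE := (dotvDl, dotvDr, dotvNl, dotvNr, dotvZl, dotvZr).

Lemma dotvBZ x w a : dotv (x - a *: w) (x - a *: w) =
  dotv x x - 2 * a * dotv x w + a ^+ 2 * dotv w w.
Proof. by rewrite !dotvE (dotvC w x); ring. Qed.

Lemma dotv_ge0 x : 0 <= dotv x x.
Proof. by apply: sumr_ge0 => i _; rewrite -expr2 sqr_ge0. Qed.

Lemma dotv_eq0 x : dotv x x = 0 -> x = 0.
Proof.
move=> /psumr_eq0P x0; apply/rowP => i; rewrite mxE; apply/eqP.
by rewrite -sqrf_eq0 expr2 x0// => j _; rewrite -expr2 sqr_ge0.
Qed.

Lemma enorm_ge0 x : 0 <= enorm x.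
Proof. exact: sqrtr_ge0. Qed.

Lemma enormE x : enorm x ^+ 2 = dotv x x.
Proof. by rewrite sqr_sqrtr// dotv_ge0. Qed.

Lemma enorm_eq0 x : enorm x = 0 -> x = 0.
Proof. by move=> x0; apply: dotv_eq0; rewrite -enormE x0 expr0n. Qed.

Lemma enormZ a x : 0 <= a -> enorm (a *: x) = a * enorm x.
Proof.
move=> a0; rewrite /enorm !dotvE mulrA -expr2 sqrtrM ?sqr_ge0//.
by rewrite sqrtr_sqr ger0_norm.
Qed.

(** Cauchy-Schwarz: expand the square of [enorm w *: x - enorm x *: w] and divide by the product of
    the norms when it is nonzero. *)
Lemma dotv_le_enorm x w : dotv x w <= enorm x * enorm w.
Proof.
have [/enorm_eq0 ->|x0] := eqVneq (enorm x) 0.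
  by rewrite -(scale0r w) dotvZl mul0r mulr_ge0 ?enorm_ge0.
have [/enorm_eq0 ->|w0] := eqVneq (enorm w) 0.
  by rewrite -(scale0r x) dotvZr mul0r mulr_ge0 ?enorm_ge0.
have xw0 : 0 < enorm x * enorm w by rewrite mulr_gt0// lt0r ?x0 ?w0 enorm_ge0.
have := dotv_ge0 (enorm w *: x - enorm x *: w).
rewrite !dotvE (dotvC w x) -!enormE => h.
rewrite -(ler_pM2l xw0); lra.
Qed.

Lemma continuous_enorm : continuous (@enorm R n).
Proof.
have dotv_cont : continuous (fun x : 'rV[R]_n => dotv x x).
  apply: continuous_big => [|i _ x]; first exact: add_continuous.
  have xi : {for x, continuous (fun v : 'rV[R]_n => v 0 i)}.
    exact: coord_continuous.
  exact: (continuousM xi xi).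
move=> x; apply: (@continuous_comp _ _ _ (fun x => dotv x x) Num.sqrt).
  exact: dotv_cont.
exact: sqrt_continuous.
Qed.

End DotProduct.

(** * Projection onto a compact convex set *)

Section Projection.
Context {R : realType} {n : nat}.
Variable X : set 'rV[R]_n.

Lemma convex_comb x w (t : R) : convex_set X -> X x -> X w -> 0 <= t <= 1 ->
  X (t *: x + (1 - t) *: w).
Proof.
move=> cX Xx Xw t01; have t01' : t \in `[0, 1] by rewrite in_itv.
by have /set_mem := cX _ _ (Itv01 (andP t01).1 (andP t01).2) (mem_set Xx) (mem_set Xw).
Qed.

Hypotheses (X0 : X !=set0) (Xcl : closed X) (Xcv : convex_set X)
  (Xbd : bounded_set X).

Lemma eproj_nearest p :
  X (eproj X p) /\ forall w, X w -> enorm (p - eproj X p) <= enorm (p - w).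
Proof.
(* The default value of [get] is excluded: the distance to [p] attains its minimum on the compact
   set [X]. *)
rewrite /eproj; case: xgetP => [z -> //|]; move=> none; exfalso.
have [|z Xz zmin] := @compact_EVT_min _ R (fun z : 'rV[R]_n => enorm (p - z)) X X0
    (bounded_closed_compact Xbd Xcl).
  apply: continuous_subspaceT => z.
  apply: (@continuous_comp _ _ _ (fun z : 'rV[R]_n => p - z) enorm).
    exact: (continuousB (@cst_continuous 'rV[R]_n 'rV[R]_n p z) (@cvg_id _ (nbhs z))).
  exact: continuous_enorm.
apply: (none z); split; first exact: set_mem.
by move=> w Xw; apply: zmin; exact: mem_set.
Qed.

(** If the inner product were positive, a short move from the projection towards [w] would come
    closer to [p]. *)
Lemma eproj_obtuse p w : X w -> dotv (p - eproj X p) (w - eproj X p) <= 0.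
Proof.
set z := eproj X p => Xw; have [Xz zmin] := eproj_nearest p; rewrite -/z in Xz zmin.
rewrite leNgt; apply/negP => h.
set d := w - z in h; set pz := p - z in h.
pose D := dotv d d; pose q := dotv pz d.
have D0 : 0 <= D := dotv_ge0 d.
have q0 : 0 < q by [].
(* [t * (1 + D) <= q] forces [2 * q - t * D > 0]; the summand 1 keeps the denominator positive. *)
pose t := Num.min 1 (q / (1 + D)).
have qD0 : 0 < q / (1 + D) by rewrite divr_gt0//; lra.
have t0 : 0 < t by rewrite lt_min ltr01.
have t1 : t <= 1 by rewrite ge_min lexx.
have tq : t * (1 + D) <= q by rewrite -ler_pdivlMr ?ge_min ?lexx ?orbT//; lra.
have Xt : X (t *: w + (1 - t) *: z) by apply: convex_comb => //; rewrite ltW.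
have := zmin _ Xt; rewrite -ler_sqr ?nnegrE ?enorm_ge0// !enormE.
have -> : p - (t *: w + (1 - t) *: z) = pz - t *: d.
  by apply/rowP => i; rewrite !mxE; ring.
rewrite -/pz dotvBZ -/D -/q => H.
have : t * (2 * q - t * D) <= 0 by lra.
rewrite pmulr_rle0//; nra.
Qed.

End Projection.

(** * First-order bounds for smooth strongly convex functions *)

Section SmoothConvex.
Context {R : realType} {n : nat}.
Variables (X : set 'rV[R]_n) (mu L : R) (F : 'rV[R]_n -> R)
  (dF : 'rV[R]_n -> 'rV[R]_n).
Hypotheses (Xcv : convex_set X) (mu0 : 0 < mu) (L0 : 0 < L).
Hypotheses (Fsc : strongly_convex_on X mu F) (Fsm : smooth_on X L F dF).

(** At [x + t *: (w - x)], strong convexity bounds [F] from above and the gradient bounds it from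
    below; divide by [t] and let [t] and the gradient error tend to 0. *)
Lemma strongly_convex_ge x w : X x -> X w ->
  F x + dotv (dF x) (w - x) + mu / 2 * enorm (w - x) ^+ 2 <= F w.
Proof.
move=> Xx Xw; set d := w - x; pose N := enorm d.
have N0 : 0 <= N := enorm_ge0 d.
have mN0 : 0 <= mu / 2 * N ^+ 2 by rewrite mulr_ge0 ?sqr_ge0// divr_ge0// ltW.
(* [C] collects the losses: [e * N] from the gradient and, since [t <= e], at most
   [e * (mu / 2 * N ^+ 2)] from the factor [1 - t]. *)
pose C := N + mu / 2 * N ^+ 2 + 1.
have C0 : 0 < C by rewrite /C; lra.
apply/ler_addgt0Pr => e' e'0.
pose e := e' / C.
have e0 : 0 < e by rewrite divr_gt0.
have eC : e * C = e' by rewrite /e divfK// gt_eqF.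
have path_cvg : x + t *: d @[t --> (0 : R)] --> x.
  rewrite -[X in _ --> X]addr0 -(scale0r d).
  by apply: cvgD; [exact: cvg_cst|apply: cvgZr_tmp; exact: cvg_id].
have [r /= r0 hr] := (nbhs_ballP _ _).1 (path_cvg _ (Fsm.1 x Xx e e0)).
pose t := Num.min (r / 2) (Num.min 1 e).
have t0 : 0 < t by rewrite !lt_min ltr01 e0 divr_gt0.
have t1 : t <= 1 by rewrite !ge_min lexx orbT.
have te : t <= e by rewrite !ge_min lexx !orbT.
have tr : t < r by rewrite gt_min (_ : r / 2 < r)//; lra.
have tball : ball (0 : R) r t by rewrite /ball/= sub0r normrN gtr0_norm.
have t01 : 0 <= t <= 1 by rewrite t1 ltW.
have xtE : x + t *: d = t *: w + (1 - t) *: x.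
  by apply/rowP => i; rewrite !mxE; ring.
have /= := hr _ tball; rewrite {1}xtE => /(_ (convex_comb Xcv Xw Xx t01)).
have -> : x + t *: d - x = t *: d by rewrite addrC addKr.
rewrite enormZ ?(ltW t0)// dotvZr -/N ler_distl xtE => /andP[lo _].
have := Fsc Xw Xx t01; rewrite -/d -/N => up.
have h : t * dotv (dF x) d + mu / 2 * (t * (1 - t)) * N ^+ 2
    <= t * (F w - F x + e * N) by lra.
have {}h : dotv (dF x) d + mu / 2 * (1 - t) * N ^+ 2 <= F w - F x + e * N.
  by rewrite -(ler_pM2l t0); lra.
have : t * (mu / 2 * N ^+ 2) <= e * (mu / 2 * N ^+ 2).
  by rewrite ler_wpM2r.
rewrite -eC /C; lra.
Qed.

Lemma convex_ge x w : X x -> X w -> F x + dotv (dF x) (w - x) <= F w.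
Proof.
move=> Xx Xw; apply: le_trans (strongly_convex_ge Xx Xw).
by rewrite lerDl mulr_ge0 ?sqr_ge0// divr_ge0// ltW.
Qed.

(* Applying the bound of rank k to both halves of the segment [x, w] halves its
   excess over L / 2. *)
Lemma smooth_le_dyadic k x w : X x -> X w ->
  F w <= F x + dotv (dF x) (w - x)
         + L / 2 * (1 + (2 ^+ k)^-1) * enorm (w - x) ^+ 2.
Proof.
have dF_lip p q v : X p -> X q -> dotv (dF q - dF p) v <= L * enorm (q - p) * enorm v.
  move=> Xp Xq; apply: le_trans (dotv_le_enorm _ _) _.
  by rewrite ler_wpM2r ?enorm_ge0//; exact: Fsm.2.
elim: k x w => [|k IH] x w Xx Xw.
  (* At rank 0 the constant is [L]: use convexity at [w], then move the gradient back to [x] by its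
     Lipschitz bound. *)
  have := convex_ge Xw Xx; have := dF_lip x w (w - x) Xx Xw.
  by rewrite !dotvE expr0 invr1; lra.
pose m := 2^-1 *: x + (1 - 2^-1) *: w.
have Xm : X m by apply: convex_comb => //; lra.
have mx : m - x = 2^-1 *: (w - x) by apply/rowP => i; rewrite !mxE; field.
have wm : w - m = 2^-1 *: (w - x) by apply/rowP => i; rewrite !mxE; field.
have := IH _ _ Xx Xm; have := IH _ _ Xm Xw; have := dF_lip x m (w - x) Xx Xm.
rewrite mx wm !enormZ ?invr_ge0// !dotvZr (dotvDl (w - x)) (dotvNl (w - x)).
(* The two halves contribute [L / 4 * (1 + c) * N ^+ 2], and the change of gradient from [x] to [m]
   at most [L / 4 * N ^+ 2]. *)
rewrite (exprS 2 k) invfM; set N := enorm _; set g := dotv _ _; set g' := dotv _ _.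
set c := (_ ^+ k)^-1; lra.
Qed.

(** The descent inequality is the limit of the dyadic bounds, which replace integration of the
    gradient along the segment. *)
Lemma smooth_le x w : X x -> X w ->
  F w <= F x + dotv (dF x) (w - x) + L / 2 * enorm (w - x) ^+ 2.
Proof.
move=> Xx Xw; set D := enorm _ ^+ 2.
have D0 : 0 <= D by exact: sqr_ge0.
apply/ler_addgt0Pr => e e0.
pose c := L / 2 * D + 1.
have c0 : 0 < c by rewrite /c ltr_wpDl// mulr_ge0// divr_ge0// ltW.
have half_cvg : (2^-1 : R) ^+ k @[k --> \oo] --> (0 : R).
  by apply: cvg_expr; rewrite ger0_norm ?invr_ge0//; lra.
have [k _ /(_ k (leqnn k))] := cvgr0_norm_lt _ half_cvg _ (divr_gt0 e0 c0).
rewrite /= exprVn ger0_norm ?invr_ge0 ?exprn_ge0//.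
rewrite ltr_pdivlMr// => kc.
have := smooth_le_dyadic k Xx Xw; rewrite -/D.
have : 0 < (2 ^+ k : R)^-1 by rewrite invr_gt0 exprn_gt0.
rewrite /c in kc; lra.
Qed.

End SmoothConvex.

(** * The estimate function along the block iterations *)

Section Block.
Context {R : realType} {n : nat}.
Variables (X : set 'rV[R]_n) (mu L : R) (F : 'rV[R]_n -> R)
  (dF : 'rV[R]_n -> 'rV[R]_n).
Hypotheses (X0 : X !=set0) (Xcl : closed X) (Xcv : convex_set X)
  (Xbd : bounded_set X) (mu0 : 0 < mu) (L0 : 0 < L).
Hypotheses (Fsc : strongly_convex_on X mu F) (Fsm : smooth_on X L F dF).

(* The estimate function of a state, in expanded form; k collects the terms
   that do not depend on x. *)
Definition estimate (s : block_state R n) (k : R) (x : 'rV[R]_n) : R :=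
  k + bGamma s / 2 * dotv x x - dotv (br s) x.

(** The constant [k] is existential because the state does not store it. *)
Definition estimate_invariant (q : quad R n) (s : block_state R n) : Prop :=
  [/\ X (bu s), X (bz s) &
    exists k, [/\ forall x, X x -> estimate s k x <= quad_eval q x + bA s * F x,
      qconst q + bA s * F (bu s) <= estimate s k (bz s)
    & forall x, X x ->
        estimate s k (bz s) + bGamma s / 2 * enorm (x - bz s) ^+ 2
        <= estimate s k x]].

(** Up to a constant the estimate is [bGamma s / 2] times the squared distance to
    [(bGamma s)^-1 *: br s], so the obtuse angle at the projection gives quadratic growth. *)
Lemma estimate_min (s : block_state R n) k x : 0 < bGamma s ->
  bz s = eproj X ((bGamma s)^-1 *: br s) -> X x ->
  estimate s k (bz s) + bGamma s / 2 * enorm (x - bz s) ^+ 2 <= estimate s k x.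
Proof.
case: s => A G u z r /= G0 zE Xx; rewrite /estimate /= enormE.
have := eproj_obtuse X0 Xcl Xcv Xbd (G^-1 *: r) Xx.
rewrite -zE => /(ler_wpM2l (ltW G0)); rewrite mulr0.
have -> : G * dotv (G^-1 *: r - z) (x - z) =
    dotv r x - dotv r z - G * (dotv z x - dotv z z).
  by rewrite !dotvE; field; rewrite gt_eqF.
rewrite !dotvE (dotvC x z); lra.
Qed.

Lemma block_step_invariant (q : quad R n) (i : nat) (s : block_state R n) :
  let a := (i + 1)%:R * qcurv q / (2 * L) in
  0 < a -> 0 <= bA s -> 0 < bGamma s -> L * a ^+ 2 <= bGamma s * (bA s + a) ->
  estimate_invariant q s ->
  estimate_invariant q (block_step X mu L dF (qcurv q) i s).
Proof.
move=> a a0; case: s => A G u z r /= A0 G0 aG [/= Xu Xz [k [/= k_le k_ge k_min]]].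
have A'0 : 0 < A + a by rewrite ltr_wpDl.
have A'n0 : A + a != 0 by rewrite gt_eqF.
have G'0 : 0 < G + mu * a by rewrite addr_gt0// mulr_gt0.
have comb x w : X x -> X w -> X ((A + a)^-1 *: (A *: x + a *: w)).
  move=> Xx Xw; have -> : (A + a)^-1 *: (A *: x + a *: w) =
      (A / (A + a)) *: x + (1 - A / (A + a)) *: w.
    by apply/rowP => j; rewrite !mxE; field.
  by apply: convex_comb => //; rewrite divr_ge0 ?(ltW A'0)//= ler_pdivrMr// mul1r lerDl ltW.
(* From here on [a] is known only through its positivity and [L * a ^+ 2 <= G * (A + a)]. *)
rewrite /block_step /= -/a; clearbody a.
set p := (A + a)^-1 *: (A *: u + a *: z).
set g := dF p; set r' := r + a *: (mu *: p - g).
set z' := eproj X _; set u' := (A + a)^-1 *: (A *: u + a *: z').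
have Xp : X p := comb _ _ Xu Xz.
have Xz' : X z' by exact: (eproj_nearest X0 Xcl Xbd _).1.
have Xu' : X u' := comb _ _ Xu Xz'.
split => //=.
(* The part of [a] times the lower bound of [F] at [p] that is free of [x]; the rest goes into [r']
   and the new curvature. *)
pose k' := k + a * (F p - dotv g p + mu / 2 * dotv p p).
exists k'.
have step_est x : estimate (BlockState (A + a) (G + mu * a) u' z' r') k' x =
    estimate (BlockState A G u z r) k x +
    a * (F p + dotv g (x - p) + mu / 2 * enorm (x - p) ^+ 2).
  rewrite /estimate /= /k' /r' enormE; move: (p) (g) => p' g'.
  by rewrite !dotvE (dotvC x p'); field.
split.
- move=> x Xx; rewrite step_est.
  have := strongly_convex_ge Xcv mu0 Fsc Fsm Xp Xx; rewrite -/g.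
  by move=> /(ler_wpM2l (ltW a0)); have := k_le x Xx; lra.
- rewrite step_est /=.
  have up : u' - p = (a / (A + a)) *: (z' - z).
    by apply/rowP => j; rewrite !mxE; field.
  have := smooth_le Xcv mu0 L0 Fsc Fsm Xp Xu'.
  rewrite -/g up (enormZ _ (divr_ge0 (ltW a0) (ltW A'0))) => /(ler_wpM2l (ltW A'0)).
  rewrite dotvZr; set N := enorm _; set D := dotv g _ => Fu'.
  have := convex_ge Xcv mu0 Fsc Fsm Xp Xu; rewrite -/g.
  move=> /(ler_wpM2l A0) Fu.
  have := k_min _ Xz'; rewrite -/N => kz'.
  (* Since [p] averages [u] and [z], [A *: (u - p) + a *: (z' - p) = a *: (z' - z)]: the linear
     terms cancel against the one in the descent inequality. *)
  have gp : A * dotv g (u - p) + a * dotv g (z' - p) = a * D.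
    rewrite /D -!dotvZr -dotvDr; congr dotv.
    by apply/rowP => j; rewrite !mxE; field.
  (* Here the step condition is spent: the old curvature [G] pays for the quadratic error of the
     descent inequality. *)
  have quad : (A + a) * (L / 2 * (a / (A + a) * N) ^+ 2) <= G / 2 * N ^+ 2.
    rewrite (_ : _ * _ = L * a ^+ 2 * (N ^+ 2 / (2 * (A + a)))); last by field.
    rewrite (_ : G / 2 * _ = G * (A + a) * (N ^+ 2 / (2 * (A + a)))); last by field.
    by rewrite ler_wpM2r// divr_ge0 ?sqr_ge0// mulr_ge0// ltW.
  have D' : (A + a) * (a / (A + a) * D) = a * D by field.
  have n0 : 0 <= a * (mu / 2 * enorm (z' - p) ^+ 2).
    by rewrite mulr_ge0 ?(ltW a0)// mulr_ge0 ?sqr_ge0// divr_ge0// ltW.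
  lra.
- by move=> x Xx; apply: estimate_min.
Qed.

Variable q : quad R n.
Hypotheses (q0 : 0 < qcurv q) (Xq : X (qcenter q)).

Lemma block_init_invariant : estimate_invariant q (block_init q).
Proof.
case: q q0 Xq => c G x0 /= G0 Xx0; split => //=.
(* With [bA] equal to 0 the estimate is the quadratic itself; this is its constant term. *)
exists (c + G / 2 * dotv x0 x0); split=> [x _||x _] /=;
  rewrite /estimate /quad_eval /= ?enormE !dotvE ?(dotvC x x0); lra.
Qed.

(** The closed form of [bA], from summing [i + 1] over the steps, is what verifies the step
    condition. *)
Lemma block_iter_invariant k : let s := block_iter X mu L dF q k in
  [/\ bA s = qcurv q / (4 * L) * (k%:R * (k%:R + 3)),
      bGamma s = qcurv q + mu * bA s & estimate_invariant q s].
Proof.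
elim: k => [|k [/= AE GE inv]].
  by split; rewrite /= ?mul0r ?mulr0 ?addr0//; exact: block_init_invariant.
set s := block_iter X mu L dF q k in AE GE inv *.
have k0 : 0 <= k%:R :> R := ler0n _ _.
have Ln0 : L != 0 by rewrite gt_eqF.
have aE : (k.+1 + 1)%:R * qcurv q / (2 * L) = qcurv q / (4 * L) * (2 * (k%:R + 2)).
  by rewrite natrD -natr1; field.
have qL0 : 0 < qcurv q / (4 * L) by rewrite divr_gt0 ?mulr_gt0.
have A0 : 0 <= bA s by rewrite AE (mulr_ge0 (ltW qL0))// mulr_ge0// addr_ge0.
split; rewrite /= ?AE ?GE ?aE.
- by rewrite -natr1; ring.
- by rewrite AE; ring.
- apply: block_step_invariant => //; rewrite ?aE ?AE.
  + by rewrite mulr_gt0// mulr_gt0// ltr_wpDl.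
  + by rewrite GE ltr_wpDr// mulr_ge0// ltW.
  (* Step [k.+1] has weight proportional to [k + 2]. As [bGamma s >= qcurv q], the condition reduces
     to [(k + 2) ^+ 2 <= (k + 1) * (k + 4)]. *)
  + have -> : L * (qcurv q / (4 * L) * (2 * (k%:R + 2))) ^+ 2 =
        qcurv q * (qcurv q / (4 * L) * (k%:R + 2) ^+ 2) by field.
    apply: (@le_trans _ _ (qcurv q * (qcurv q / (4 * L) *
        (k%:R * (k%:R + 3) + 2 * (k%:R + 2))))).
      by rewrite (ler_wpM2l (ltW q0))// (ler_wpM2l (ltW qL0))//; lra.
    rewrite -mulrDr ler_wpM2r//; last by rewrite GE lerDl mulr_ge0// ltW.
    by rewrite (mulr_ge0 (ltW qL0))// addr_ge0// mulr_ge0// addr_ge0.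
Qed.

Lemma block_ge k u z A x : (u, z, A) = block X mu L dF q k -> X x ->
  [/\ 0 <= A, X z &
    qconst q + A * F u + (qcurv q + mu * A) / 2 * enorm (x - z) ^+ 2
    <= quad_eval q x + A * F x].
Proof.
rewrite /block => -[-> -> ->] Xx.
have [AE GE [_ Xz [c [c_le c_ge c_min]]]] := block_iter_invariant k.
split => //.
  by rewrite AE mulr_ge0// divr_ge0 ?(ltW q0)// mulr_ge0// ltW.
rewrite -GE; apply: le_trans (c_le x Xx); apply: le_trans (c_min x Xx).
by rewrite lerD2r.
Qed.

End Block.

(** * Concavity in y and the new lower model *)

Lemma concave_comb (R : realType) (m : nat) (Y : set 'rV[R]_m)
    (h : 'rV[R]_m -> R) (y w : 'rV[R]_m) (t : R) :
  concave_on Y h -> Y y -> Y w -> 0 <= t <= 1 ->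
  t * h y + (1 - t) * h w <= h (t *: y + (1 - t) *: w).
Proof.
move=> hY Yy Yw /andP[t0 t1].
have : - h (t *: y + (1 - t) *: w) <= t * - h y + (1 - t) * - h w.
  exact: (hY (Itv01 t0 t1) _ _ (mem_set Yy) (mem_set Yw)).
lra.
Qed.

Theorem corollary7 (R : realType) (n m : nat)
    (X : set 'rV[R]_n) (Y : set 'rV[R]_m)
    (f : 'rV[R]_n -> 'rV[R]_m -> R)
    (gradf : 'rV[R]_m -> 'rV[R]_n -> 'rV[R]_n)
    (mu L My : R)
    (X_nonempty : X !=set0) (X_closed : closed X)
    (X_convex : convex_set X) (X_bounded : bounded_set X)
    (Y_compact : compact Y) (Y_convex : convex_set Y)
    (Y_relint : has_relative_interior Y)
    (mu_gt0 : 0 < mu) (L_gt0 : 0 < L)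
    (f_strongly_convex :
       forall y, Y y -> strongly_convex_on X mu (fun x => f x y))
    (f_smooth : forall y, Y y -> smooth_on X L (fun x => f x y) (gradf y))
    (f_concave : forall x, X x -> concave_on Y (f x))
    (f_supergradient : forall x y, X x -> Y y ->
       exists s, supergradient Y (f x) y s /\ enorm s <= My)
    (b : R) (xb : 'rV[R]_n) (yb : 'rV[R]_m)
    (b_lower : lower_model X Y f (mu / 2) b xb yb)
    (yc : 'rV[R]_m) (yc_in : Y yc) (K : nat) (K_ge1 : (1 <= K)%N)
    (u z : 'rV[R]_n) (A : R)
    (uzA_block : (u, z, A) = block X mu L (gradf yc) (Quad b (mu / 2) xb) K) :
  let v := f u yc in
  let theta := A / (1 + A) in
  let b' := (b + A * v) / (1 + A) in
  let xb' := z in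
  let yb' := (1 - theta) *: yb + theta *: yc in
  yb' = (1 + A)^-1 *: (yb + A *: yc) /\
  lower_model X Y f (mu / 2) b' xb' yb'.
Proof.
move=> v theta b' xb' yb'; have [Xxb Yyb b_le] := b_lower.
have blk x : X x -> [/\ 0 <= A, X z & b + A * v +
    (mu / 2 + mu * A) / 2 * enorm (x - z) ^+ 2
    <= quad_eval (Quad b (mu / 2) xb) x + A * f x yc].
  exact: (@block_ge R n X mu L (f^~ yc) (gradf yc) X_nonempty X_closed
    X_convex X_bounded mu_gt0 L_gt0 (f_strongly_convex yc yc_in) (f_smooth yc yc_in)
    (Quad b (mu / 2) xb) (divr_gt0 mu_gt0 (ltr0Sn _ 1)) Xxb K u z A x uzA_block).
have [A0 Xz _] := blk _ Xxb.
have A1 : 0 < 1 + A by lra.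
have A1n0 : 1 + A != 0 by rewrite gt_eqF.
have theta01 : 0 <= 1 - theta <= 1.
  by rewrite subr_ge0 gerBl /theta ler_pdivrMr// mul1r lerDr ler01 divr_ge0// ltW.
have yb'E : yb' = (1 - theta) *: yb + (1 - (1 - theta)) *: yc.
  by rewrite subKr.
split; first by apply/rowP => j; rewrite /yb' /theta !mxE; field.
split => // [|x Xx].
  by rewrite yb'E; exact: convex_comb.
rewrite yb'E; apply: le_trans (concave_comb (f_concave x Xx) Yyb yc_in theta01).
have [_ _ le1] := blk x Xx; have le2 := b_le x Xx.
have -> : (1 - theta) * f x yb + (1 - (1 - theta)) * f x yc =
    (f x yb + A * f x yc) / (1 + A) by rewrite /theta; field.
rewrite ler_pdivlMr// /quad_eval /= /b' mulrDl divfK//.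
(* After multiplication by [1 + A], the available curvature [mu / 2 + mu * A] exceeds the required
   [(1 + A) * (mu / 2)] by [mu * A / 2]. *)
have : 0 <= mu * A * enorm (x - z) ^+ 2 by rewrite mulr_ge0 ?sqr_ge0// mulr_ge0// ltW.
rewrite /xb'; lra.
Qed.
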